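(* Let $J=[0,\infty)$, let $f:J\to\mathbb{R}$ be a function that is differentiable on $J^{\circ}=(0,\infty)$, and let $a,b\in J$ with $0<a<b$. If $f'\in L[a,b]$, then $$\frac{1}{b-a}\int_{a}^{b}f(x)\,dx+\frac{a f(b)-b f(a)}{2(b-a)}-\frac12 f\left(\frac{a+b}{2}\right)$$ $$=\frac14\int_{0}^{1}\bigl(tb+(1-t)a\bigr)f'\left(\frac{1-t}{2}b+\frac{1+t}{2}a\right)dt+\frac14\int_{0}^{1}\bigl(ta+(1-t)b\bigr)f'\left(\frac{1-t}{2}a+\frac{1+t}{2}b\right)dt .$$
   Context: $L[a,b]$ denotes the space of (Lebesgue) integrable functions on $[a,b]$. *)

(* Defs.v *)
(* - A function on [0, +oo[ is represented by a total function R -> R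
     constrained only on that interval. [derivable f x 1] and [derive1 f x]
     depend only on the values of f near x, so for x > 0 the values of f at
     negative points play no role.
   - [lebesgue_measure] lives on the Borel sigma-algebra. This loses no
     generality for [derive1 f] on [a, b]: an everywhere-defined derivative is
     a pointwise limit of continuous functions, hence Borel. *)
From mathcomp Require Import all_boot all_order all_algebra.
From mathcomp Require Import all_classical all_reals all_analysis.

(* Main.v *)
(* Substituting u = (1-t)/2 b + (1+t)/2 a in the first integral and
   u = (1-t)/2 a + (1+t)/2 b in the second turns them into integrals of
   (2a + b - 2u) f'(u) over [a, m] and of (2b + a - 2u) f'(u) over [m, b],
   m = (a + b) / 2, which are integrated by parts. Since f' is only Lebesgue
   integrable, this rests on the fundamental theorem of calculus for everywhere
   differentiable functions with integrable derivative. Its core is the bound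
   F b - F a <= \int h for F' <= h, 0 <= h: take a majorant v of h which near
   each x is at least h x and has almost the same integral; then
   \int_a^x v - F x + d x is locally, hence globally, nondecreasing for
   all d > 0. *)
Require Import Defs.
From mathcomp Require Import all_boot all_order all_algebra.
From mathcomp Require Import all_classical all_reals all_analysis.
From mathcomp Require Import measurable_realfun ring lra.
Import Order.TTheory GRing.Theory Num.Theory.
Import numFieldNormedType.Exports.
Local Open Scope classical_set_scope.
Local Open Scope ring_scope.

(** * From local to global monotonicity *)

(** Consider the supremum of the points [x] with [F a <= F x]. Comparison on its left puts it into
    the set; if it were below [b], comparison on its right would put a larger point there. No
    continuity of [F] enters. *)
Lemma locally_nondecreasing_le (R : realType) (F : R -> R) (a b : R) : a <= b ->
  (forall x, a <= x <= b -> \forall y \near x,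
     (a <= y <= x -> F y <= F x) /\ (x <= y <= b -> F x <= F y)) ->
  F a <= F b.
Proof.
move=> ab locF.
pose S := [set x | a <= x <= b /\ F a <= F x].
have Sa : S a by split; rewrite ?lexx ?ab.
have ubS : ubound S b by move=> x [/andP[]].
have hS : has_sup S by split; [exists a | exists b].
have aS : a <= sup S by apply: ub_le_sup => //; exists b.
have Sb : sup S <= b by apply: ge_sup => //; exists a.
have /nbhs_ballP[e /= e0 He] := locF _ (introT andP (conj aS Sb)).
have SS : S (sup S).
  split; first by rewrite aS.
  have [y Sy ye] := sup_adherent e0 hS.
  have yS : y <= sup S by apply: ub_le_sup => //; exists b.
  have [/andP[ay yb] Fay] := Sy.
  apply: (le_trans Fay); apply (He y).
    by rewrite /ball/= ger0_norm ?subr_ge0//; lra.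
  by rewrite ay.
move: Sb; rewrite le_eqVlt => /predU1P[<-|Sb]; first by case: SS.
pose y := Num.min (sup S + e / 2) b.
have e2 : 0 < e / 2 by rewrite divr_gt0.
have Sy : sup S < y by rewrite lt_min Sb andbT ltrDl.
have yb : y <= b by rewrite ge_min lexx orbT.
have ye : y <= sup S + e / 2 by rewrite ge_min lexx.
have : S y.
  split; first by rewrite yb andbT (le_trans aS)// ltW.
  apply: (le_trans SS.2); apply (He y).
    by rewrite /ball/= distrC gtr0_norm ?subr_gt0//; lra.
  by rewrite (ltW Sy).
move=> /(ub_le_sup (ex_intro _ b ubS)).
by rewrite leNgt Sy.
Qed.

(** * Majorants that dominate an integrable function locally *)

(** If the last term counts, then [N * d <= t] and the [N] earlier terms add up to at most [N * d].
    This bounds the staircase of mesh [d] built on a function by that function plus [d]. *)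
Lemma sum_steps_le (R : realType) (d t : R) (N : nat) : 0 < d -> 0 <= t ->
  \sum_(0 <= k < N) d * (k%:R * d <= t)%R%:R <= t + d.
Proof.
move=> d0 t0; elim: N => [|N IHN]; first by rewrite big_geq// addr_ge0// ltW.
rewrite big_nat_recr//=; have [Nt|_] := boolP (N%:R * d <= t); last first.
  by rewrite mulr0 addr0.
rewrite mulr1 lerD2r (le_trans _ Nt)//.
have -> : N%:R * d = \sum_(0 <= k < N) d by rewrite sumr_const_nat subn0 mulr_natl.
by apply: ler_sum => k _; case: (_ <= t); rewrite ?mulr1// mulr0 ltW.
Qed.

(* The majorant is [d * \sum_k 1_(U k)], with [U k] an open set slightly larger
   than [{x in D | k d <= h x}]; it dominates [h x] near [x] because finitely
   many of the [U k] suffice for that. *)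
Lemma near_majorant (R : realType) (D : set (measurableTypeR R))
    (h : R -> R) (e : R) :
  measurable D -> (lebesgue_measure D < +oo)%E ->
  lebesgue_measure.-integrable D (EFin \o h) ->
  (forall x : R, D x -> 0 <= h x) -> 0 < e ->
  exists v : R -> \bar R, [/\ measurable_fun [set: measurableTypeR R] v,
    forall x, (0 <= v x)%E,
    (\int[lebesgue_measure]_(x in D) v x <=
      \int[lebesgue_measure]_(x in D) (h x)%:E + e%:E)%E &
    forall x : R, D x -> \forall y \near x, ((h x)%:E <= v y)%E].
Proof.
move=> mD Doo ih h0 e0.
have [/measurable_EFinP mh _] := integrableP _ _ _ ih.
pose mu := @lebesgue_measure R.
have muD : mu D = (fine (mu D))%:E by rewrite fineK// ge0_fin_numE.
have muD0 : 0 <= fine (mu D) by rewrite fine_ge0.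
(* Chosen so that [d * mu D + d = e]: the first summand pays for rounding [h] up to the staircase on
   [D], the second for enlarging the [A k] to open sets. *)
pose d := e / (fine (mu D) + 1).
have d0 : 0 < d by rewrite divr_gt0// ltr_wpDl.
have dge0 : 0 <= d by exact/ltW.
pose A k := D `&` [set x | k%:R * d <= h x].
have mA k : measurable (A k : set (measurableTypeR R)).
  have := mh mD _ (measurable_itv `[k%:R * d, +oo[).
  by congr measurable; apply/seteqP; split => x /=; rewrite in_itv/= andbT.
(* Outer regularity. The excesses, below [1 / 2 ^ k.+1], sum to at most 1, so after the factor [d]
   they cost at most [d] in total. *)
have /choice[U UP] : forall k, exists U : set R, [/\ open U, A k `<=` U &
    (mu (U `\` A k) < (1 / (2 ^ k.+1)%:R)%:E)%E].
  move=> k; apply: lebesgue_regularity_outer; first exact: mA.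
  - apply: le_lt_trans Doo; apply: le_measure; rewrite ?inE//; exact: subIsetl.
  - by rewrite divr_gt0// ltr0n expn_gt0.
have mU k : measurable (U k : set (measurableTypeR R)).
  by have [oU _ _] := UP k; exact: open_measurable.
have mfU (B : set (measurableTypeR R)) : measurable B ->
    measurable_fun [set: measurableTypeR R] (fun x => (d * \1_B x)%:E).
  move=> mB; apply/measurable_EFinP; apply: measurable_funM.
    exact: measurable_cst.
  exact: measurable_indic.
have fU0 B (x : R) : (0 <= (d * \1_B x)%:E)%E.
  by rewrite lee_fin indicE mulr_ge0.
have intB (B : set (measurableTypeR R)) : measurable B ->
    (\int[mu]_(x in D) (d * \1_B x)%:E = d%:E * mu (B `&` D))%E.
  move=> mB; under eq_integral do rewrite EFinM.
  rewrite ge0_integralZl_EFin//.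
    by rewrite integral_indic.
  by apply/measurable_EFinP; exact: measurable_indic.
exists (fun x => (\sum_(k <oo) (d * \1_(U k) x)%:E)%E); split.
- by apply: ge0_emeasurable_sum => // k _; exact: mfU.
- by move=> x; exact: nneseries_ge0.
- rewrite integral_nneseries//; last by move=> k; apply: measurable_funTS; exact: mfU.
  have step k : (\int[mu]_(x in D) (d * \1_(U k) x)%:E <=
      d%:E * mu (A k) + (d / (2 ^ k.+1)%:R)%:E)%E.
    rewrite intB//.
    have [_ _ /ltW UAk] := UP k.
    have -> : (d%:E * mu (A k) + (d / (2 ^ k.+1)%:R)%:E =
        d%:E * (mu (A k) + (1 / (2 ^ k.+1)%:R)%:E))%E.
      by rewrite ge0_muleDr// -EFinM div1r.
    apply: lee_wpmul2l; first by rewrite lee_fin.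
    apply: le_trans (leeD2l _ UAk).
    apply: le_trans (measureU2 _ (mA k) (measurableD (mU k) (mA k))).
    apply: le_measure; rewrite ?inE.
    + exact: measurableI.
    + by apply: measurableU => //; exact: measurableD.
    + by move=> x [Ux _]; have [Ax|Ax] := pselect (A k x); [left|right].
  apply: (le_trans (lee_nneseries _ (fun k _ => step k))) => //.
    by move=> k _ _; apply: integral_ge0.
  apply: (le_trans (epsilon_trick _ _ dge0)).
    by move=> k; rewrite mule_ge0// lee_fin ltW.
  have -> : (\sum_(k <oo) d%:E * mu (A k) =
      \int[mu]_(x in D) \sum_(k <oo) (d * \1_(A k) x)%:E)%E.
    rewrite integral_nneseries//; last by move=> k; apply: measurable_funTS; exact: mfU.
    by apply: eq_eseriesr => k _; rewrite intB// /A setIAC setIid.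
  have -> : (e%:E = d%:E * mu D + d%:E)%E.
    rewrite muD -EFinM -EFinD; congr EFin; rewrite /d; field.
    by rewrite gt_eqF// ltr_wpDl.
  rewrite addeA; apply: leeD2r.
  rewrite -integral_cst// -ge0_integralD//; last first.
    exact/measurable_EFinP.
  apply: ge0_le_integral => //.
  + by move=> x _; exact: nneseries_ge0.
  + by apply: measurable_funTS; apply: ge0_emeasurable_sum => // k _; exact: mfU.
  + by apply/emeasurable_funD => //; exact/measurable_EFinP.
  + move=> x Dx; apply: lime_le; first exact: is_cvg_nneseries.
    apply: nearW => N; rewrite sumEFin -EFinD lee_fin.
    apply: le_trans (sum_steps_le R d (h x) N d0 (h0 _ Dx)).
    apply: ler_sum => k _; rewrite indicE ler_pM2l// ler_nat.
    by have [/set_mem[_ /= ->]|] := boolP (x \in A k).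
(* The least natural number with [h x < N * d]. Each [k < N] has [k * d <= h x], so [x] lies in the
   open sets [U k], and on their finite intersection the sum is at least [N * d]. *)
- move=> x Dx; pose N := (Num.truncn (h x / d)).+1.
  have hN : h x <= N%:R * d.
    by rewrite -ler_pdivrMr//; apply/ltW; apply: truncnS_gt.
  have : \forall y \near x, forall k : 'I_N, U k y.
    apply: (@filter_forall _ _ (fun k : 'I_N => U k) _ (nbhs_filter x)) => k.
    have [oU AU _] := UP k; apply: open_nbhs_nbhs; split => //; apply: AU; split => //=.
    rewrite -ler_pdivlMr// (@le_trans _ _ (Num.truncn (h x / d))%:R)//
      ?truncn_le ?(divr_ge0 (h0 _ Dx) dge0)//.
    by rewrite ler_nat -ltnS.
  apply: filterS => y Uy.
  apply: le_trans (nneseries_lim_ge N _) => //.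
  rewrite big_mkord sumEFin lee_fin (le_trans hN)//.
  rewrite (eq_bigr (fun=> d)); first by rewrite sumr_const card_ord mulr_natl.
  by move=> k _; rewrite indicE mem_set ?mulr1//.
Qed.

(** * The fundamental theorem of calculus for integrable derivatives *)

(** Multiplying the difference quotient estimate by [y - x] removes the division, so that [y = x] is
    included. *)
Lemma derivable_near_dist_le (R : realType) (F : R -> R) (x e : R) :
  derivable F x 1 -> 0 < e ->
  \forall y \near x, `|F y - F x - derive1 F x * (y - x)| <= e * `|y - x|.
Proof.
move=> dF e0; have : h^-1 *: (F (h + x) - F x) @[h --> 0^'] --> derive1 F x.
  rewrite derive1E /derive; have := dF; rewrite /derivable => /cvg_ex[l Hl].
  rewrite (cvg_lim _ Hl)//; move: Hl.
  by under eq_fun do rewrite [_%:A]mulr1.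
move=> /cvgr_dist_le/(_ e e0)/nbhs_ballP[r /= r0 Hr].
apply/nbhs_ballP; exists r => // y xy.
have [->|yx] := eqVneq y x; first by rewrite !subrr mulr0 subr0 normr0 mulr0.
have yxr : ball 0 r (y - x) by rewrite /ball/= sub0r normrN distrC.
have := Hr _ yxr; rewrite subr_eq0 => /(_ yx).
have yx0 : y - x != 0 by rewrite subr_eq0.
rewrite subrK -(ler_pM2r (_ : 0 < `|y - x|)) ?normr_gt0// -normrM.
rewrite mulrBl mulrAC /GRing.scale/= mulVf// mul1r.
by rewrite distrC.
Qed.

Lemma derive1_le_Rintegral (R : realType) (F h : R -> R) (a b : R) : a <= b ->
  (forall x, a <= x <= b -> derivable F x 1) ->
  (forall x, a <= x <= b -> 0 <= h x) ->
  (forall x, a <= x <= b -> derive1 F x <= h x) ->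
  lebesgue_measure.-integrable `[a, b] (EFin \o h) ->
  F b - F a <= \int[lebesgue_measure]_(x in `[a, b]) h x.
Proof.
move=> ab dF h0 Fh ih; set mu := lebesgue_measure.
apply/ler_addgt0Pr => e e0.
have e20 : 0 < e / 2 by rewrite divr_gt0.
have mab : measurable (`[a, b]%classic : set (measurableTypeR R)) by [].
have abE x : `[a, b]%classic x = (a <= x <= b) by rewrite /= in_itv.
have [||v [mv v0 iv hv]] := @near_majorant R `[a, b]%classic h (e / 2)
    mab _ ih _ e20.
- by rewrite lebesgue_measure_itv/=; case: ifP => _; rewrite -?EFinB ltry.
- by move=> x; rewrite abE; exact: h0.
have ihfin := integrable_fin_num mab ih.
have ivb : (\int[mu]_(x in `[a, b]) v x < +oo)%E.
  by apply: le_lt_trans iv _; rewrite -(fineK ihfin) -EFinD ltry.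
have mvS (D : set (measurableTypeR R)) : measurable_fun D v by exact: measurable_funTS.
pose I x := fine (\int[mu]_(t in `[a, x]) v t).
have Ifin x : x <= b -> (\int[mu]_(t in `[a, x]) v t)%E \is a fin_num.
  move=> xb; rewrite ge0_fin_numE; last exact: integral_ge0.
  apply: le_lt_trans ivb; apply: ge0_subset_integral => //.
  by apply: subset_itvl; rewrite bnd_simp.
(* The increment of [I] is the integral of [v] over []x, y]], where [v] is at least [c]. *)
have I_incr x y c : 0 <= c -> a <= x -> x <= y -> y <= b ->
    (forall z, x <= z <= y -> (c%:E <= v z)%E) -> c * (y - x) <= I y - I x.
  move=> c0 ax xy yb cv.
  have xb := le_trans xy yb.
  have ayE : `[a, y]%classic = `[a, x]%classic `|` `]x, y]%classic.
    by rewrite -itv_bndbnd_setU ?bnd_simp.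
  have IyE : (\int[mu]_(t in `[a, y]) v t =
      \int[mu]_(t in `[a, x]) v t + \int[mu]_(t in `]x, y]) v t)%E.
    rewrite ayE ge0_integral_setU//.
    apply/disj_setPRL => z /=; rewrite !in_itv/= => /andP[xz _].
    by apply/negP; rewrite negb_and -!ltNge xz orbT.
  have : (c%:E * mu `]x, y]%classic <= \int[mu]_(t in `]x, y]) v t)%E.
    rewrite -integral_cst//; apply: ge0_le_integral => //.
    by move=> z /=; rewrite in_itv/= => /andP[xz zy]; apply: cv; rewrite (ltW xz).
  have -> : mu `]x, y]%classic = (y - x)%:E.
    rewrite /mu lebesgue_measure_itv/= lte_fin; case: ltP => // yx.
    by rewrite (@le_anti _ _ x y) ?xy// subrr.
  have := Ifin _ yb; rewrite /I IyE fin_numD => /andP[fx fy].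
  by rewrite fineD// -(fineK fy) -EFinM lee_fin /=; lra.
(* One half of [e] is spent on the majorant, the other on the slope [d] over [[a, b]]; the added 1
   keeps the denominator positive when [a = b]. *)
pose d := e / 2 / (b - a + 1).
have d0 : 0 < d by rewrite divr_gt0// ltr_wpDl// subr_ge0.
have db : d * (b - a) <= e / 2.
  rewrite -[leRHS](@divfK _ (b - a + 1)) ?gt_eqF ?ltr_wpDl ?subr_ge0//.
  by rewrite ler_pM2l// lerDl.
pose G x := I x - F x + d * x.
have : G a <= G b.
  apply: locally_nondecreasing_le => // x axb.
  have /andP[ax xb] := axb.
  have /nbhs_ballP[r1 /= r10 vr] := hv x (eq_ind_r id axb (abE x)).
  have /nbhs_ballP[r2 /= r20 Fr] := derivable_near_dist_le _ _ _ _ (dF _ axb) d0.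
  apply/nbhs_ballP; exists (Num.min r1 r2); first by rewrite /= lt_min r10.
  move=> y; rewrite /ball/= lt_min => /andP[yr1 yr2].
  have Fy := Fr y yr2; have Fhx := Fh x axb.
  (* On either side of [x], the whole segment between [x] and [y] lies in the ball where [v] is at
     least [h x]. So [I] changes at rate at least [h x], [F] at rate at most [derive1 F x + d], and
     the term [d * x] makes up the difference. *)
  split => /andP[? ?].
  - have := I_incr y x (h x) (h0 _ axb).
    have vz z : y <= z <= x -> ((h x)%:E <= v z)%E.
      move=> /andP[? ?]; apply: vr; rewrite /ball/=.
      by apply: le_lt_trans yr1; rewrite !ger0_norm ?subr_ge0 ?lerB//; lra.
    move=> H; have {}H : h x * (x - y) <= I x - I y by apply: H.
    move: Fy; rewrite [`|y - x|]distrC (@ger0_norm _ (x - y)) ?subr_ge0//.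
    rewrite ler_norml => /andP[Fy _].
    have : derive1 F x * (x - y) <= h x * (x - y) by rewrite ler_wpM2r ?subr_ge0.
    rewrite /G => Fhxy; clear -H Fy Fhxy; lra.
  - have := I_incr x y (h x) (h0 _ axb).
    have vz z : x <= z <= y -> ((h x)%:E <= v z)%E.
      move=> /andP[? ?]; apply: vr; rewrite /ball/=.
      move: yr1; rewrite distrC [X in _ -> X < _]distrC; apply: le_lt_trans.
      by rewrite !ger0_norm ?subr_ge0 ?lerB//; lra.
    move=> H; have {}H : h x * (y - x) <= I y - I x by apply: H.
    move: Fy; rewrite (@ger0_norm _ (y - x)) ?subr_ge0//.
    rewrite ler_norml => /andP[_ Fy].
    have : derive1 F x * (y - x) <= h x * (y - x) by rewrite ler_wpM2r ?subr_ge0.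
    rewrite /G => Fhxy; clear -H Fy Fhxy; lra.
have Ia : I a = 0 by rewrite /I set_itv1 integral_set1.
have Ib : I b <= \int[mu]_(x in `[a, b]) h x + e / 2.
  have := Ifin b (lexx b); rewrite /I /Rintegral => fb.
  by rewrite -lee_fin EFinD !fineK.
rewrite /G Ia; move: (I b) (\int[mu]_(x in `[a, b]) h x) Ib => Ib Jb IJ.
clear -db IJ; lra.
Qed.

(* The previous bound needs a nonnegative [h], so it is applied to [F x + n x]
   with [h = max(F', - n) + n], and then [n] tends to infinity. *)
Lemma derive1_integrable_le_Rintegral (R : realType) (F : R -> R) (a b : R) : a <= b ->
  (forall x, a <= x <= b -> derivable F x 1) ->
  lebesgue_measure.-integrable `[a, b] (EFin \o derive1 F) ->
  F b - F a <= \int[lebesgue_measure]_(x in `[a, b]) derive1 F x.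
Proof.
move=> ab dF iF; set mu := lebesgue_measure.
have mab : measurable (`[a, b]%classic : set (measurableTypeR R)) by [].
pose g (n : nat) (x : R) : R := Num.max (derive1 F x) (- n%:R).
(* Truncation from below only replaces values under [- n] by [- n]; this is the domination needed
   for the limit. *)
have gF n x : `|g n x| <= `|derive1 F x|.
  rewrite /g; have [//|Fn] := lerP (- n%:R) (derive1 F x).
  by rewrite !ler0_norm ?oppr_le0// ?lerN2 ?(le_trans (ltW Fn)) ?oppr_le0// ltW.
have [mF _] := integrableP _ _ _ iF.
have mg n : measurable_fun (`[a, b]%classic : set (measurableTypeR R)) (g n).
  by apply: measurable_maxr => //; exact/measurable_EFinP.
have ig n : mu.-integrable `[a, b] (EFin \o g n).
  apply: le_integrable iF => //; first exact/measurable_EFinP.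
  by move=> x _ /=; rewrite lee_fin.
have icst (c : R) : mu.-integrable `[a, b] (EFin \o cst c).
  apply: continuous_compact_integrable; first exact: segment_compact.
  by apply: continuous_subspaceT => x; exact: cvg_cst.
have step n : F b - F a <= \int[mu]_(x in `[a, b]) g n x.
  have := @derive1_le_Rintegral R (fun x => F x + n%:R * x)
    (fun x => g n x + n%:R) a b ab.
  have dG x : a <= x <= b -> is_derive x 1 (fun x => F x + n%:R * x) (derive1 F x + n%:R).
    move=> xab; have := derivableP (dF x xab); rewrite -derive1E => dFx.
    by apply: is_derive_eq; rewrite /GRing.scale/= mulr1.
  have : mu.-integrable `[a, b] (EFin \o (fun x => g n x + n%:R)).
    exact: integrableD (ig n) (icst n%:R).
  move=> /[swap] H /H{}H.
  have : F b + n%:R * b - (F a + n%:R * a) <=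
      \int[mu]_(x in `[a, b]) (g n x + n%:R).
    apply: H => x xab; first by have [] := dG x xab.
    - by rewrite -lerBlDr sub0r le_max lexx orbT.
    - by have := dG x xab => ?; rewrite derive1E derive_val lerD2r le_max lexx.
  rewrite (RintegralD mab (ig n) (icst n%:R)) Rintegral_cst//.
  have -> : fine (mu `[a, b]%classic) = b - a.
    rewrite /mu lebesgue_measure_itv/= lte_fin; case: ltP => // ba.
    by rewrite (@le_anti _ _ a b) ?ab// subrr.
  rewrite /=; move: (\int[mu]_(x in `[a, b]) g n x) => J; lra.
have [||||_ _ gcvg] := @dominated_convergence _ _ _ mu _ mab (fun n => EFin \o g n)
  (EFin \o derive1 F) (fun x => `|(derive1 F x)%:E|%E) _ mF.
- by move=> n; exact/measurable_EFinP.
(* At a fixed [x] the truncation is inactive as soon as [n >= - derive1 F x]. *)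
- apply: aeW => x _; apply: cvg_near_cst.
  near=> n; rewrite /= /g; congr EFin; apply/max_idPl.
  rewrite lerNl; near: n; exact: nbhs_infty_ger.
- exact: integrable_abse.
- by apply: aeW => x n _ /=; rewrite lee_fin.
have ifin := integrable_fin_num mab iF.
rewrite -lee_fin /Rintegral fineK//.
apply: (cvge_ge _ gcvg); apply: nearW => n /=.
by rewrite -(fineK (integrable_fin_num mab (ig n))) lee_fin; exact: step.
Unshelve. all: by end_near. Qed.

(** The one-sided bound is applied to both [F] and [- F]. *)
Theorem Rintegral_derive1 (R : realType) (F : R -> R) (a b : R) : a <= b ->
  (forall x, a <= x <= b -> derivable F x 1) ->
  lebesgue_measure.-integrable `[a, b] (EFin \o derive1 F) ->
  \int[lebesgue_measure]_(x in `[a, b]) derive1 F x = F b - F a.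
Proof.
move=> ab dF iF.
have mab : measurable (`[a, b]%classic : set (measurableTypeR R)) by [].
apply/eqP; rewrite eq_le derive1_integrable_le_Rintegral// andbT.
have dN x : a <= x <= b -> derive1 (- F) x = - derive1 F x.
  by move=> xab; rewrite !derive1E deriveN//; exact: dF.
have iNF : lebesgue_measure.-integrable `[a, b] (EFin \o (fun x => -1 * derive1 F x)).
  exact: (integrableZl mab (-1) iF).
have := @derive1_integrable_le_Rintegral R (- F) a b ab.
have -> : \int[lebesgue_measure]_(x in `[a, b]) derive1 (- F) x =
    - \int[lebesgue_measure]_(x in `[a, b]) derive1 F x.
  rewrite -[RHS]mulN1r -RintegralZl//; apply: eq_Rintegral => x.
  by rewrite inE/= in_itv/= mulN1r => /dN.
rewrite /= opprK [leLHS]addrC lerNr opprB; apply.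
- by move=> x /dF; exact: derivableN.
- apply: eq_integrable iNF => // x; rewrite inE/= in_itv/= => /dN ->.
  by rewrite mulN1r.
Qed.

(** * Affine change of variables *)

(** By uniqueness of Lebesgue measure it suffices that the pushforward scaled by [|c|] gives
    half-open intervals their length. *)
Lemma lebesgue_measure_affine (R : realType) (c m : R) (A : set R) :
  c != 0 -> measurable A ->
  lebesgue_measure A =
  (`|c|%:E * lebesgue_measure ((fun t => c * t + m)%R @^-1` A))%E.
Proof.
move=> c0 mA.
have mphi : measurable_fun [set: measurableTypeR R]
    ((fun t : R => c * t + m) : _ -> measurableTypeR R).
  by apply: measurable_funD => //; exact: measurable_funM.
pose k := NngNum (normr_ge0 c).
pose phi : R -> measurableTypeR R := fun t : R => c * t + m.
suff H : lebesgue_measure A =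
    mscale k (pushforward (@lebesgue_measure R) phi) A.
  exact: (H mphi).
move=> mf.
apply: lebesgue_measure_unique => //.
move=> X /ocitvP[->|[[x y]/= xy ->]].
  by rewrite !measure0.
rewrite /mscale/= /pushforward lebesgue_measure_itv/= lte_fin xy.
have [c_gt0|c_lt0|/eqP] := ltgtP c 0; last by rewrite (negbTE c0).
(* This is the case [c < 0]: the map reverses order, so the preimage of []x, y]] is closed on the
   left and open on the right. *)
- rewrite (_ : _ @^-1` _ = `[(y - m) / c, (x - m) / c[%classic); last first.
    apply/seteqP; split => t; rewrite /phi/= !in_itv/= ler_ndivrMr// ltr_ndivlMr//;
    move=> /andP[? ?]; apply/andP; split; lra.
  rewrite lebesgue_measure_itv/= lte_fin ltr_ndivlMr// divfK// ltrD2r xy.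
  by rewrite ltr0_norm// -!EFinB -EFinM; congr EFin; field.
- rewrite (_ : _ @^-1` _ = `](x - m) / c, (y - m) / c]%classic); last first.
    apply/seteqP; split => t; rewrite /phi/= !in_itv/= ltr_pdivrMr// ler_pdivlMr//;
    move=> /andP[? ?]; apply/andP; split; lra.
  rewrite lebesgue_measure_itv/= lte_fin ltr_pdivlMr// divfK// ltrD2r xy.
  by rewrite gtr0_norm// -!EFinB -EFinM; congr EFin; field.
Qed.

Lemma ge0_integral_affine (R : realType) (c m : R) (D : set R) (g : R -> \bar R) :
  c != 0 -> measurable D -> measurable_fun D g -> (forall x, 0 <= g x)%E ->
  (\int[lebesgue_measure]_(x in D) g x =
   `|c|%:E * \int[lebesgue_measure]_(t in (fun t => c * t + m)%R @^-1` D)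
     g (c * t + m)%R)%E.
Proof.
move=> c0 mD mg g0.
have mphi : measurable_fun [set: measurableTypeR R]
    ((fun t : R => c * t + m) : _ -> measurableTypeR R).
  by apply: measurable_funD => //; exact: measurable_funM.
pose k := NngNum (normr_ge0 c).
pose phi : R -> measurableTypeR R := fun t : R => c * t + m.
suff H : (\int[lebesgue_measure]_(x in D) g x =
    \int[mscale k (pushforward (@lebesgue_measure R) phi)]_(x in D) g x)%E.
  by rewrite (H mphi) ge0_integral_mscale// ge0_integral_pushforward.
by move=> mf; apply: eq_measure_integral => A mA _; exact: lebesgue_measure_affine.
Qed.

(** The nonnegative case is applied to the positive and negative parts of [g]. Both integrals are
    finite, which permits factoring [|c|] out of their difference. *)
Lemma Rintegral_affine (R : realType) (c m : R) (D : set (measurableTypeR R))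
    (g : R -> R) :
  c != 0 -> measurable D -> lebesgue_measure.-integrable D (EFin \o g) ->
  \int[lebesgue_measure]_(x in D) g x =
  `|c| * \int[lebesgue_measure]_(t in (fun t => c * t + m) @^-1` D) g (c * t + m).
Proof.
move=> c0 mD ig.
have [mg _] := integrableP _ _ _ ig.
rewrite /Rintegral -[X in X * _]/(fine `|c|%:E).
have ipos := integrable_funepos mD ig.
have ineg := integrable_funeneg mD ig.
have posE := @ge0_integral_affine R c m D _ c0 mD (measurable_funepos mg)
  (funepos_ge0 _).
have negE := @ge0_integral_affine R c m D _ c0 mD (measurable_funeneg mg)
  (funeneg_ge0 _).
have fp : (`|c|%:E * \int[lebesgue_measure]_(t in (fun t => c * t + m)%R @^-1` D)
     ((EFin \o g)^\+ (c * t + m)%R))%E \is a fin_num.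
  by rewrite -posE; exact: integrable_fin_num ipos.
have fn : (`|c|%:E * \int[lebesgue_measure]_(t in (fun t => c * t + m)%R @^-1` D)
     ((EFin \o g)^\- (c * t + m)%R))%E \is a fin_num.
  by rewrite -negE; exact: integrable_fin_num ineg.
have fin_of (x : \bar R) : (`|c|%:E * x)%E \is a fin_num -> x \is a fin_num.
  move=> cx; have -> : x = (`|c|^-1%:E * (`|c|%:E * x))%E.
    by rewrite muleA -EFinM mulVf ?mul1e ?normr_eq0.
  exact: fin_numM.
have LE := integralE lebesgue_measure D (EFin \o g).
have RE := integralE lebesgue_measure ((fun t => c * t + m) @^-1` D)
  (fun t => (g (c * t + m))%:E).
have posN : (fun t => (g (c * t + m))%:E)^\+%E
    = (fun t => (EFin \o g)^\+%E (c * t + m))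
  by exact: (funepos_comp (EFin \o g) (fun t => c * t + m)).
have negN : (fun t => (g (c * t + m))%:E)^\-%E
    = (fun t => (EFin \o g)^\-%E (c * t + m))
  by exact: (funeneg_comp (EFin \o g) (fun t => c * t + m)).
rewrite posN negN in RE.
rewrite posE negE in LE.
move: (fin_of _ fp) (fin_of _ fn) => {}fp {}fn.
rewrite -muleBr// in LE; last by rewrite fin_num_adde_defr.
rewrite -RE in LE.
by rewrite [in LHS]LE fineM// RE fin_numB fp fn.
Qed.

(** * Integration by parts against an affine weight *)

Lemma integrable_derivable (R : realType) (f : R -> R) (x y : R) :
  (forall u, x <= u <= y -> derivable f u 1) ->
  lebesgue_measure.-integrable `[x, y] (EFin \o f).
Proof.
move=> df; apply: continuous_compact_integrable; first exact: segment_compact.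
by apply: derivable_within_continuous => u; rewrite in_itv/=; exact: df.
Qed.

Lemma integrable_affineM (R : realType) (g : R -> R) (x y p q : R) :
  lebesgue_measure.-integrable `[x, y] (EFin \o g) ->
  lebesgue_measure.-integrable `[x, y] (EFin \o (fun u => (p + q * u) * g u)).
Proof.
move=> ig.
have mxy : measurable (`[x, y]%classic : set (measurableTypeR R)) by [].
have mh : measurable_fun (`[x, y]%classic : set (measurableTypeR R))
    (fun u : R => p + q * u).
  by apply: measurable_funD => //; exact: measurable_funM.
suff bh : [bounded p + q * u | u in (`[x, y]%classic : set (measurableTypeR R))].
  exact: (integrableMr mxy mh bh ig).
(* Every [u] between [x] and [y] satisfies [|u| <= |x| + |y|]. *)
exists (`|p| + `|q| * (`|x| + `|y|)); split; first exact: num_real.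
move=> M /ltW bM u /=; rewrite in_itv/= => /andP[xu uy].
apply: le_trans bM; apply: (le_trans (ler_normD _ _)).
rewrite lerD2l normrM ler_wpM2l// ler_norml.
have := ler_norm y; have := ler_norm (- x); rewrite normrN.
have := normr_ge0 x; have := normr_ge0 y.
by move: `|x| `|y| => X Y *; apply/andP; split; lra.
Qed.

(** The fundamental theorem is applied to the product [G], whose derivative is a sum of two
    integrable terms; the term [q * f] is then moved across. *)
Lemma Rintegral_affineM_derive1 (R : realType) (f : R -> R) (x y p q : R) : x <= y ->
  (forall u, x <= u <= y -> derivable f u 1) ->
  lebesgue_measure.-integrable `[x, y] (EFin \o derive1 f) ->
  \int[lebesgue_measure]_(u in `[x, y]) ((p + q * u) * derive1 f u) =
  (p + q * y) * f y - (p + q * x) * f x -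
    q * \int[lebesgue_measure]_(u in `[x, y]) f u.
Proof.
move=> xy df if'.
have mxy : measurable (`[x, y]%classic : set (measurableTypeR R)) by [].
pose G u := (p + q * u) * f u.
have dG u : x <= u <= y -> is_derive u 1 G ((p + q * u) * derive1 f u + q * f u).
  move=> xuy; have := derivableP (df u xuy); rewrite -derive1E => dfu.
  apply: is_derive_eq; rewrite /GRing.scale/=; ring.
have dGE u : x <= u <= y -> derive1 G u = (p + q * u) * derive1 f u + q * f u.
  by move=> /dG ?; rewrite derive1E derive_val.
have iw := @integrable_affineM R _ x y p q if'.
have iff := @integrable_derivable R f x y df.
have iqf : lebesgue_measure.-integrable `[x, y] (EFin \o (fun u => q * f u)).
  exact: (integrableZl mxy q iff).
have iG : lebesgue_measure.-integrable `[x, y] (EFin \o derive1 G).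
  apply: eq_integrable (integrableD mxy iw iqf) => // u.
  by rewrite inE/= in_itv/= => /dGE ->.
have := @Rintegral_derive1 R G x y xy
  (fun u xuy => @ex_derive _ _ _ _ _ _ _ (dG u xuy)) iG.
rewrite -/(G y) -/(G x) => <-; rewrite -RintegralZl// -RintegralB//.
by apply: eq_Rintegral => u; rewrite inE/= in_itv/= => /dGE ->; rewrite addrK.
Qed.

(** * The identity, by splitting at the midpoint *)

Theorem lemma1 (R : realType) (f : R -> R) (a b : R)
  (fdiff : forall x : R, 0 < x -> derivable f x 1)
  (a_gt0 : 0 < a) (ltab : a < b)
  (f'L : lebesgue_measure.-integrable `[a, b] (EFin \o derive1 f)) :
  1 / (b - a) * (\int[lebesgue_measure]_(x in `[a, b]) f x)
    + (a * f b - b * f a) / (2 * (b - a)) - 1 / 2 * f ((a + b) / 2)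
  = 1 / 4 * (\int[lebesgue_measure]_(t in `[0, 1])
       ((t * b + (1 - t) * a) * derive1 f ((1 - t) / 2 * b + (1 + t) / 2 * a)))
    + 1 / 4 * (\int[lebesgue_measure]_(t in `[0, 1])
       ((t * a + (1 - t) * b) * derive1 f ((1 - t) / 2 * a + (1 + t) / 2 * b))).
Proof.
pose m := (a + b) / 2; pose d := (b - a) / 2.
have d0 : 0 < d by rewrite /d; lra.
have dn0 : d != 0 by rewrite gt_eqF.
have nd0 : - d != 0 by rewrite oppr_eq0.
have aE : a = m - d by rewrite /m /d; field.
have bE : b = m + d by rewrite /m /d; field.
have dE : `|d| = d by rewrite gtr0_norm.
have nE : `|- d| = d by rewrite normrN.
have am : a <= m by rewrite /m; lra.
have mb : m <= b by rewrite /m; lra.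
have df x y : a <= x -> forall u, x <= u <= y -> derivable f u 1.
  by move=> ax u /andP[xu _]; apply: fdiff; exact: lt_le_trans (le_trans ax xu).
have if'S x y : a <= x -> y <= b ->
    lebesgue_measure.-integrable `[x, y] (EFin \o derive1 f).
  move=> ax yb; apply: (integrableS _ _ _ f'L) => //.
  by apply: subset_itv; rewrite bnd_simp.
(* With [u = m - d * t], the weight is [a + 2 * d * t = a + 2 * (m - u) = 2 * a + b - 2 * u]. *)
have I1 : \int[lebesgue_measure]_(t in `[0, 1])
       ((t * b + (1 - t) * a) * derive1 f ((1 - t) / 2 * b + (1 + t) / 2 * a)) =
    d^-1 * \int[lebesgue_measure]_(u in `[a, m])
      ((2 * a + b + -2 * u) * derive1 f u).
  have mD : measurable (`[a, m]%classic : set (measurableTypeR R)) by [].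
  have := @Rintegral_affine R (- d) m `[a, m]%classic
    (fun u => (2 * a + b + -2 * u) * derive1 f u) nd0 mD.
  have iD := @integrable_affineM R _ a m (2 * a + b) (-2) (if'S a m (lexx a) mb).
  move=> /(_ iD) ->; rewrite nE.
  rewrite (mulKf dn0).
  have -> : (fun t => (- d) * t + m) @^-1` `[a, m]%classic = `[0, 1]%classic.
    apply/funext => t /=; rewrite !in_itv/= aE mulNr [_ + m]addrC lerD2l lerN2.
    by rewrite ger_pMr// gerDl oppr_le0 pmulr_rge0// andbC.
  by apply: eq_Rintegral => t _; congr (_ * derive1 f _); rewrite /m /d; field.
(* With [u = m + d * t], the weight is [b - 2 * d * t = b - 2 * (u - m) = 2 * b + a - 2 * u]. *)
have I2 : \int[lebesgue_measure]_(t in `[0, 1])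
       ((t * a + (1 - t) * b) * derive1 f ((1 - t) / 2 * a + (1 + t) / 2 * b)) =
    d^-1 * \int[lebesgue_measure]_(u in `[m, b])
      ((2 * b + a + -2 * u) * derive1 f u).
  have mD : measurable (`[m, b]%classic : set (measurableTypeR R)) by [].
  have := @Rintegral_affine R d m `[m, b]%classic
    (fun u => (2 * b + a + -2 * u) * derive1 f u) dn0 mD.
  have iD := @integrable_affineM R _ m b (2 * b + a) (-2) (if'S m b am (lexx b)).
  move=> /(_ iD) ->; rewrite dE.
  rewrite (mulKf dn0).
  have -> : (fun t => d * t + m) @^-1` `[m, b]%classic = `[0, 1]%classic.
    apply/funext => t /=; rewrite !in_itv/= bE lerDr pmulr_rge0//.
    by rewrite [_ + m]addrC lerD2l ger_pMr.
  by apply: eq_Rintegral => t _; congr (_ * derive1 f _); rewrite /m /d; field.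
(* The weights fall from [b] to [a] on each half, so the boundary terms are [a * f m - b * f a] and
   [a * f b - b * f m]. The two integrals of [f], each with factor 2, join into one over
   [[a, b]]. *)
rewrite I1 I2 !Rintegral_affineM_derive1//; try by [apply: df | apply: if'S].
have := @Rintegral_itvB R f (BLeft a) (BRight b) m
  (@integrable_derivable _ _ _ _ (df a b (lexx a))).
rewrite !bnd_simp => /(_ am mb); rewrite Rintegral_itv_obnd_cbnd; last first.
  apply: (integrableS _ _ _ (@integrable_derivable _ _ _ _ (df m b am))) => //.
  by apply: subset_itv; rewrite bnd_simp.
move=> <-; rewrite /m /d; field.
by rewrite subr_eq0 gt_eqF.
Qed.
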